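(* Let $R$ be a commutative unital ring and let $I$ be any ideal of $R$. Then: 1. The functor $\Gamma_I : (R\text{-Mod})_{I\text{-red}} \rightarrow (R\text{-Mod})_{I\text{-cor}}$ is idempotent, and for any $M\in (R\text{-Mod})_{I\text{-red}}$, $\Gamma_I(M)\cong \mathrm{Hom}_R(R/I, M)$. (In particular $\Gamma_I$ sends $I$-reduced modules to $I$-coreduced modules.) 2. The functor $\Lambda_I : (R\text{-Mod})_{I\text{-cor}} \rightarrow (R\text{-Mod})_{I\text{-red}}$ is idempotent, and for any $M\in (R\text{-Mod})_{I\text{-cor}}$, $\Lambda_I(M)\cong R/I\otimes_R M$. (In particular $\Lambda_I$ sends $I$-coreduced modules to $I$-reduced modules.) 3. For any $N\in (R\text{-Mod})_{I\text{-red}}$ and $M\in (R\text{-Mod})_{I\text{-cor}}$, $$\mathrm{Hom}_R(\Lambda_I(M), N)\cong \mathrm{Hom}_R(M, \Gamma_I(N)).$$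
   Context: $R\text{-Mod}$ is the category of $R$-modules. The $I$-torsion functor is $\Gamma_I(M):=\varinjlim_k \mathrm{Hom}_R(R/I^k, M)$ and the $I$-adic completion functor is $\Lambda_I(M):=\varprojlim_k M/I^kM$, both endofunctors of $R\text{-Mod}$. For an $R$-module $M$ and $a\in R$ let $f_a:M\to M$ be $m\mapsto am$, and $f_a^2=f_a\circ f_a$. $M$ is $I$-reduced if $\mathrm{Ker} f_a\cong \mathrm{Ker} f_a^2$ for every $a\in I$, and $I$-coreduced if $\mathrm{Coker} f_a\cong \mathrm{Coker} f_a^2$ for every $a\in I$. $(R\text{-Mod})_{I\text{-red}}$ and $(R\text{-Mod})_{I\text{-cor}}$ denote the full subcategories of $R\text{-Mod}$ of all $I$-reduced, respectively $I$-coreduced, $R$-modules. Idempotent means that applying the functor twice gives a result naturally isomorphic to applying it once. *)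

(* Defs.v *)
From HB Require Import structures.
From mathcomp Require Import all_boot all_algebra.
From mathcomp Require Import boolp classical_sets functions cardinality.

Set Implicit Arguments.
Unset Strict Implicit.
Unset Printing Implicit Defensive.

Import GRing.Theory.
Local Open Scope ring_scope.
Local Open Scope classical_set_scope.
Local Open Scope quotient_scope.

(* Submodules are the library's [submodClosed V]; classically (boolp) every
   subset is a boolean predicate, so these are all the submodules.  An ideal is
   a submodule of the regular module R^o.  The library's [idealr] is not used:
   it excludes the unit ideal and the zero ring. *)
Notation ideal R := (submodClosed R^o).

Section Submodule.
Variables (R : comPzRingType) (V : lmodType R).

Section Submod.
Variable S : submodClosed V.

Definition submod := {x : V | x \in S}.
HB.instance Definition _ := SubChoice.on submod.
HB.instance Definition _ := [SubChoice_isSubLmodule of submod by <:].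

End Submod.

(* The same predicate seen as an additive subgroup, so that the library
   quotient [Quotient.quot] applies. *)
Definition zmod_pred (S : submodClosed V) : {pred V} := fun x => x \in S.

Fact zmod_pred_closed S : zmod_closed (zmod_pred S).
Proof.
have [S0 SP] := submodClosedP S; split=> // x y Sx Sy.
by rewrite unfold_in -scaleN1r addrC; apply: SP.
Qed.
HB.instance Definition _ S :=
  GRing.isZmodClosed.Build V (zmod_pred S) (zmod_pred_closed S).

Section Quotmod.
Variable S : submodClosed V.

Definition quotmod : Type := Quotient.quot (zmod_pred S : zmodClosed V).
HB.instance Definition _ := Choice.on quotmod.
HB.instance Definition _ := GRing.Zmodule.on quotmod.
HB.instance Definition _ := Quotient.on quotmod.

Definition quot_pi (x : V) : quotmod := \pi x.
Definition quot_scale (a : R) (x : quotmod) : quotmod := quot_pi (a *: repr x).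

Lemma quot_piP x y : quot_pi x = quot_pi y <-> x - y \in S.
Proof.
have := Quotient.idealrBE (zmod_pred S : zmodClosed V) x y.
by rewrite [LHS]unfold_in => ->; split=> [/eqP | /eqP].
Qed.

Lemma quot_piK (x : quotmod) : quot_pi (repr x) = x.
Proof. exact: reprK. Qed.

Lemma quot_piD : {morph quot_pi : x y / x + y}.
Proof. by move=> x y; exact: Quotient.pi_add. Qed.

Lemma quot_scale_pi a x : quot_scale a (quot_pi x) = quot_pi (a *: x).
Proof.
apply/quot_piP; rewrite -scalerBr; apply: rpredZ; apply/quot_piP.
exact: quot_piK.
Qed.

Fact quot_scaleA a b x : quot_scale a (quot_scale b x) = quot_scale (a * b) x.
Proof. by rewrite -[x]quot_piK !quot_scale_pi scalerA. Qed.
Fact quot_scale1 : left_id 1 quot_scale.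
Proof. by move=> x; rewrite -[x]quot_piK quot_scale_pi scale1r. Qed.
Fact quot_scaleDr : right_distributive quot_scale +%R.
Proof.
move=> a x y; rewrite -[x]quot_piK -[y]quot_piK !quot_scale_pi.
by rewrite -!quot_piD quot_scale_pi scalerDr.
Qed.
Fact quot_scaleDl x : {morph quot_scale^~ x : a b / a + b}.
Proof.
by move=> a b; rewrite -[x]quot_piK !quot_scale_pi -quot_piD scalerDl.
Qed.
HB.instance Definition _ := GRing.Zmodule_isLmodule.Build R quotmod
  quot_scaleA quot_scale1 quot_scaleDr quot_scaleDl.

Fact quot_pi_linear : linear quot_pi.
Proof. by move=> a x y; rewrite quot_piD -quot_scale_pi. Qed.
HB.instance Definition _ :=
  GRing.isLinear.Build R V quotmod *:%R quot_pi quot_pi_linear.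

End Quotmod.

Section Span.
Variable A : set V.

Definition span : {pred V} :=
  fun x => `[< forall S : submodClosed V, (forall y, A y -> y \in S) -> x \in S >].

Fact span_closed : submod_closed span.
Proof.
split=> [|a x y /asboolP Sx /asboolP Sy]; apply/asboolP => S AS.
  exact: rpred0.
by rewrite rpredD ?rpredZ ?Sx ?Sy.
Qed.
HB.instance Definition _ := GRing.isSubmodClosed.Build R V span span_closed.

Lemma sub_span x : A x -> x \in span.
Proof. by move=> Ax; apply/asboolP => S; apply. Qed.

Lemma span_sub (S : submodClosed V) :
  (forall y, A y -> y \in S) -> {subset span <= S}.
Proof. by move=> AS x /asboolP; apply. Qed.

End Span.

Definition fullm : {pred V} := predT.
Fact fullm_closed : submod_closed fullm. Proof. by []. Qed.
HB.instance Definition _ := GRing.isSubmodClosed.Build R V fullm fullm_closed.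

End Submodule.
Arguments fullm {R} V _.

Section Linear.
Variables (R : comPzRingType) (U V : lmodType R).

Section KerIm.
Variable f : {linear U -> V}.

Definition kerm : {pred U} := fun x => f x == 0.
Fact kerm_closed : submod_closed kerm.
Proof.
split=> [|a x y /eqP fx /eqP fy]; first by rewrite unfold_in linear0.
by rewrite unfold_in linearP fx fy scaler0 addr0.
Qed.
HB.instance Definition _ := GRing.isSubmodClosed.Build R U kerm kerm_closed.

Definition imm : {pred V} := fun y => `[< exists x, f x = y >].
Fact imm_closed : submod_closed imm.
Proof.
split=> [|a _ _ /asboolP[x <-] /asboolP[y <-]]; apply/asboolP.
  by exists 0; rewrite linear0.
by exists (a *: x + y); rewrite linearP.
Qed.
HB.instance Definition _ := GRing.isSubmodClosed.Build R V imm imm_closed.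

Definition Ker : lmodType R := submod kerm.
Definition Coker : lmodType R := quotmod imm.
End KerIm.

HB.instance Definition _ := gen_eqMixin {linear U -> V}.
HB.instance Definition _ := gen_choiceMixin {linear U -> V}.

Lemma linear_ext (f g : {linear U -> V}) : f =1 g -> f = g.
Proof.
case: f g => [f [[a] [b]]] [g [[c] [d]]] /= /funext efg.
move: a b c d; rewrite {}efg => a b c d.
by rewrite (Prop_irrelevance a c) (Prop_irrelevance b d).
Qed.

Definition Hom0 : {linear U -> V} := \0.
Definition HomN (f : {linear U -> V}) : {linear U -> V} := \- f.
Definition HomD (f g : {linear U -> V}) : {linear U -> V} := f \+ g.
Definition HomZ a (f : {linear U -> V}) : {linear U -> V} := a \*: f.

Fact HomDA : associative HomD.
Proof. by move=> f g h; apply: linear_ext => x /=; rewrite addrA. Qed.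
Fact HomDC : commutative HomD.
Proof. by move=> f g; apply: linear_ext => x /=; rewrite addrC. Qed.
Fact Hom0D : left_id Hom0 HomD.
Proof. by move=> f; apply: linear_ext => x /=; rewrite add0r. Qed.
Fact HomND : left_inverse Hom0 HomN HomD.
Proof. by move=> f; apply: linear_ext => x /=; rewrite addNr. Qed.
HB.instance Definition _ :=
  GRing.isZmodule.Build {linear U -> V} HomDA HomDC Hom0D HomND.

Fact HomZA a b f : HomZ a (HomZ b f) = HomZ (a * b) f.
Proof. by apply: linear_ext => x /=; rewrite scalerA. Qed.
Fact Hom1Z : left_id 1 HomZ.
Proof. by move=> f; apply: linear_ext => x /=; rewrite scale1r. Qed.
Fact HomZDr : right_distributive HomZ +%R.
Proof. by move=> a f g; apply: linear_ext => x /=; rewrite scalerDr. Qed.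
Fact HomZDl f : {morph HomZ^~ f : a b / a + b}.
Proof. by move=> a b; apply: linear_ext => x /=; rewrite scalerDl. Qed.
HB.instance Definition _ := GRing.Zmodule_isLmodule.Build R {linear U -> V}
  HomZA Hom1Z HomZDr HomZDl.

Definition HomR : lmodType R := {linear U -> V}.

Definition lmod_iso := exists f : {linear U -> V}, bijective f.

End Linear.

Notation "U ≅ V" := (lmod_iso U V) (at level 70).

Section Induced.
Variables (R : comPzRingType) (U V : lmodType R) (f : {linear U -> V}).

Section Quot.
Variables (S : submodClosed U) (T : submodClosed V).
Hypothesis fST : forall x, x \in S -> f x \in T.

Definition quot_map (_ : forall x, x \in S -> f x \in T) (x : quotmod S) :
    quotmod T :=
  quot_pi T (f (repr x)).

Lemma quot_map_pi x : quot_map fST (quot_pi S x) = quot_pi T (f x).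
Proof.
apply/quot_piP; rewrite -linearB; apply: fST; apply/quot_piP.
exact: quot_piK.
Qed.

Fact quot_map_linear : linear (quot_map fST).
Proof.
move=> a x y; rewrite -[x]quot_piK -[y]quot_piK -linearP !quot_map_pi.
by rewrite !linearP.
Qed.
HB.instance Definition _ := GRing.isLinear.Build R (quotmod S) (quotmod T) *:%R
  (quot_map fST) quot_map_linear.
End Quot.

Section Sub.
Variables (S : submodClosed U) (T : submodClosed V).
Hypothesis fST : forall x, x \in S -> f x \in T.

Definition sub_map (x : submod S) : submod T := exist _ (f (val x)) (fST (valP x)).

Fact sub_map_linear : linear sub_map.
Proof. by move=> a x y; apply: val_inj; rewrite /= !linearP. Qed.
HB.instance Definition _ := GRing.isLinear.Build R (submod S) (submod T) *:%R
  sub_map sub_map_linear.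
End Sub.

Lemma span_map (A : set U) (B : set V) :
  (forall x, A x -> B (f x)) -> forall x, x \in span A -> f x \in span B.
Proof.
move=> fAB x /asboolP Sx; apply/asboolP => T BT.
pose P : {pred U} := fun x => f x \in T.
have PE y : (y \in P) = (f y \in T) by [].
have Pcl : submod_closed P.
  split=> [|a y z]; rewrite !PE; first by rewrite linear0 rpred0.
  by move=> Ty Tz; rewrite linearP rpredD ?rpredZ.
pose PM := GRing.isSubmodClosed.Build R U P Pcl.
pose PS : submodClosed U := HB.pack P PM.
by apply: (Sx PS) => y /fAB; apply: BT.
Qed.

Variable W : lmodType R.

Definition Hom_post (g : HomR W U) : HomR W V := f \o g.
Fact Hom_post_linear : linear Hom_post.
Proof. by move=> a g h; apply: linear_ext => x /=; rewrite linearP. Qed.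
HB.instance Definition _ :=
  GRing.isLinear.Build R (HomR W U) (HomR W V) *:%R Hom_post Hom_post_linear.

Definition Hom_pre (g : HomR V W) : HomR U W := g \o f.
Fact Hom_pre_linear : linear Hom_pre.
Proof. by move=> a g h; apply: linear_ext. Qed.
HB.instance Definition _ :=
  GRing.isLinear.Build R (HomR V W) (HomR U W) *:%R Hom_pre Hom_pre_linear.

End Induced.
Arguments Hom_post {R U V} f {W} g.
Arguments Hom_pre {R U V} f {W} g.
Arguments quot_map {R U V} f {S T} fST.
Arguments sub_map {R U V} f {S T} fST.

Section Product.
Variables (R : comPzRingType) (J : Type) (V : J -> lmodType R).

Definition dprod : Type := forall j, V j.
HB.instance Definition _ := Choice.on dprod.

Definition dprod0 : dprod := fun=> 0.
Definition dprodN (x : dprod) : dprod := fun j => - x j.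
Definition dprodD (x y : dprod) : dprod := fun j => x j + y j.
Definition dprodZ a (x : dprod) : dprod := fun j => a *: x j.

Fact dprodDA : associative dprodD.
Proof. by move=> x y z; apply: functional_extensionality_dep => j; apply: addrA. Qed.
Fact dprodDC : commutative dprodD.
Proof. by move=> x y; apply: functional_extensionality_dep => j; apply: addrC. Qed.
Fact dprod0D : left_id dprod0 dprodD.
Proof. by move=> x; apply: functional_extensionality_dep => j; apply: add0r. Qed.
Fact dprodND : left_inverse dprod0 dprodN dprodD.
Proof. by move=> x; apply: functional_extensionality_dep => j; apply: addNr. Qed.
HB.instance Definition _ :=
  GRing.isZmodule.Build dprod dprodDA dprodDC dprod0D dprodND.

Fact dprodZA a b x : dprodZ a (dprodZ b x) = dprodZ (a * b) x.
Proof. by apply: functional_extensionality_dep => j; apply: scalerA. Qed.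
Fact dprod1Z : left_id 1 dprodZ.
Proof. by move=> x; apply: functional_extensionality_dep => j; apply: scale1r. Qed.
Fact dprodZDr : right_distributive dprodZ +%R.
Proof. by move=> a x y; apply: functional_extensionality_dep => j; apply: scalerDr. Qed.
Fact dprodZDl x : {morph dprodZ^~ x : a b / a + b}.
Proof. by move=> a b; apply: functional_extensionality_dep => j; apply: scalerDl. Qed.
HB.instance Definition _ := GRing.Zmodule_isLmodule.Build R dprod
  dprodZA dprod1Z dprodZDr dprodZDl.

Definition finsupp : {pred dprod} :=
  fun x => `[< finite_set [set j | x j != 0] >].
Fact finsupp_closed : submod_closed finsupp.
Proof.
split=> [|a x y /asboolP fx /asboolP fy]; apply/asboolP.
  suff -> : [set j | (0 : dprod) j != 0] = set0 by exact: finite_set0.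
  by apply/seteqP; split=> j //=; rewrite eqxx.
apply: (@sub_finite_set _ _ ([set j | x j != 0] `|` [set j | y j != 0])).
  move=> j /= nz; apply/orP; apply: contraR nz; rewrite negb_or !negbK.
  case/andP=> /eqP xj /eqP yj.
  by rewrite -[X in X == 0]/(a *: x j + y j) xj yj scaler0 addr0.
by rewrite finite_setU.
Qed.
HB.instance Definition _ := GRing.isSubmodClosed.Build R dprod finsupp finsupp_closed.

Definition dsum : lmodType R := submod finsupp.

End Product.

Section Injection.
Variables (R : comPzRingType) (J : eqType) (V : J -> lmodType R).

Fact dfwith_finsupp j (v : V j) : (dfwith (0 : dprod V) v : dprod V) \in finsupp (V := V).
Proof.
apply/asboolP; apply: (@sub_finite_set _ _ [set j]); last exact: finite_set1.
move=> i /=; apply: contra_neqP => /eqP ij.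
by rewrite dfwith_out // eq_sym.
Qed.

Definition dsum_inj j (v : V j) : dsum V :=
  exist (fun x => x \in finsupp (V := V)) _ (dfwith_finsupp v).

End Injection.

Section Limits.
Variable R : comPzRingType.

Record dirsys := DirSys {
  dir_obj :> nat -> lmodType R;
  dir_map : forall k, {linear dir_obj k -> dir_obj k.+1} }.

Definition colim_rel (X : dirsys) : set (dsum X) :=
  [set z | exists k (x : X k), z = dsum_inj (dir_map X k x) - dsum_inj x].

Definition colim (X : dirsys) : lmodType R := quotmod (span (@colim_rel X)).

Record invsys := InvSys {
  inv_obj :> nat -> lmodType R;
  inv_map : forall k, {linear inv_obj k.+1 -> inv_obj k} }.

Section Lim.
Variable X : invsys.

Definition compatible : {pred dprod X} :=
  fun x => `[< forall k, inv_map X k (x k.+1) = x k >].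
Fact compatible_closed : submod_closed compatible.
Proof.
split=> [|a x y /asboolP cx /asboolP cy]; apply/asboolP => k.
  exact: linear0.
by rewrite -[X in _ = X]/(a *: x k + y k) -cx -cy -linearP.
Qed.
HB.instance Definition _ :=
  GRing.isSubmodClosed.Build R (dprod X) compatible compatible_closed.

Definition ilim : lmodType R := submod compatible.
End Lim.

End Limits.

Section Tensor.
Variables (R : comPzRingType) (A B : lmodType R).

(* The free module on the set A * B. *)
Definition free_pairs : lmodType R := dsum (fun _ : A * B => R^o : lmodType R).
Definition pair_gen (a : A) (b : B) : free_pairs :=
  @dsum_inj R (A * B)%type (fun=> R^o : lmodType R) (a, b) 1.

Inductive tensor_rel : set free_pairs :=
| TensorDl a a' b : tensor_rel (pair_gen (a + a') b - pair_gen a b - pair_gen a' b)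
| TensorDr a b b' : tensor_rel (pair_gen a (b + b') - pair_gen a b - pair_gen a b')
| TensorZl r a b : tensor_rel (pair_gen (r *: a) b - r *: pair_gen a b)
| TensorZr r a b : tensor_rel (pair_gen a (r *: b) - r *: pair_gen a b).

Definition tensor : lmodType R := quotmod (span tensor_rel).

End Tensor.

Notation "A ⊗ B" := (tensor A B) (at level 40).

Section DirectSumMap.
Variables (R : comPzRingType).

Section Map.
Variables (J : Type) (U V : J -> lmodType R) (f : forall j, {linear U j -> V j}).

Definition dprod_map (x : dprod U) : dprod V := fun j => f j (x j).
Fact dprod_map_linear : linear dprod_map.
Proof. by move=> a x y; apply: functional_extensionality_dep => j; apply: linearP. Qed.
HB.instance Definition _ :=
  GRing.isLinear.Build R (dprod U) (dprod V) *:%R dprod_map dprod_map_linear.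

Fact dprod_map_finsupp x :
  x \in finsupp (V := U) -> dprod_map x \in finsupp (V := V).
Proof.
move=> /asboolP fx; apply/asboolP; apply: sub_finite_set fx => j /=.
by apply: contra_neq => xj; rewrite /dprod_map xj linear0.
Qed.

Definition dsum_map : {linear dsum U -> dsum V} := sub_map dprod_map dprod_map_finsupp.
End Map.

Lemma dsum_map_inj (J : eqType) (U V : J -> lmodType R)
    (f : forall j, {linear U j -> V j}) j (x : U j) :
  dsum_map f (dsum_inj x) = dsum_inj (f j x).
Proof.
apply: val_inj; apply: functional_extensionality_dep => i /=; rewrite /dprod_map.
have [->|ij] := eqVneq i j; first by rewrite !dfwith_in.
by rewrite !dfwith_out 1?eq_sym // linear0.
Qed.

Section Colim.
Variables (X Y : dirsys R) (f : forall k, {linear X k -> Y k}).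
Hypothesis fE : forall k x, f k.+1 (dir_map X k x) = dir_map Y k (f k x).

Fact colim_rel_map z :
  z \in span (@colim_rel R X) -> dsum_map f z \in span (@colim_rel R Y).
Proof.
apply: span_map => _ [k [x ->]]; exists k, (f k x).
by rewrite linearB !dsum_map_inj fE.
Qed.

Definition colim_map : {linear colim X -> colim Y} := quot_map (dsum_map f) colim_rel_map.
End Colim.

Section Lim.
Variables (X Y : invsys R) (f : forall k, {linear X k -> Y k}).
Hypothesis fE : forall k x, f k (inv_map X k x) = inv_map Y k (f k.+1 x).

Fact compatible_map x :
  x \in compatible (X := X) -> dprod_map f x \in compatible (X := Y).
Proof.
by move=> /asboolP cx; apply/asboolP => k; rewrite /dprod_map -fE cx.
Qed.

Definition ilim_map : {linear ilim X -> ilim Y} := sub_map (dprod_map f) compatible_map.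
End Lim.
End DirectSumMap.

Section IdealProduct.
Variables (R : comPzRingType) (I : ideal R).

Definition ideal_mul (V : lmodType R) (N : submodClosed V) : submodClosed V :=
  span [set z | exists a v, [/\ a \in I, v \in N & z = a *: v]].

End IdealProduct.

Section IAdic.
Variables (R : comPzRingType) (I : ideal R).

Fixpoint ideal_exp (k : nat) : ideal R :=
  if k is k'.+1 then ideal_mul I (ideal_exp k') else fullm (R^o : lmodType R).

(* The submodule I^k M of M. *)
Definition expM (M : lmodType R) (k : nat) : submodClosed M :=
  ideal_mul (ideal_exp k) (fullm M).

Lemma ideal_exp_sub k x : x \in ideal_exp k.+1 -> x \in ideal_exp k.
Proof.
apply: span_sub => _ [a [v [_ vI ->]]]; exact: rpredZ.
Qed.

Lemma expM_map (M N : lmodType R) (f : {linear M -> N}) k x :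
  x \in expM M k -> f x \in expM N k.
Proof.
apply: span_map => _ [a [v [aI _ ->]]]; exists a, (f v).
by split; rewrite // linearZ.
Qed.

Lemma expM_sub (M : lmodType R) k x : x \in expM M k.+1 -> x \in expM M k.
Proof.
apply: span_sub => _ [a [v [aI vM ->]]]; apply: sub_span.
by exists a, v; split=> //; apply: ideal_exp_sub.
Qed.

(* Both systems start at k = 0, where I^0 = R: that term is the zero module and
   does not affect the colimit or the limit. *)
Definition Gamma_sys (M : lmodType R) : dirsys R :=
  @DirSys R (fun k => HomR (quotmod (ideal_exp k)) M)
    (fun k => Hom_pre (quot_map idfun (@ideal_exp_sub k))).

Definition Lambda_sys (M : lmodType R) : invsys R :=
  @InvSys R (fun k => quotmod (expM M k))
    (fun k => quot_map idfun (@expM_sub M k)).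

Section Maps.
Variables (M N : lmodType R) (f : {linear M -> N}).

Definition Gamma_map_at k : {linear Gamma_sys M k -> Gamma_sys N k} :=
  Hom_post f.
Fact Gamma_map_atE k x :
  Gamma_map_at k.+1 (dir_map (Gamma_sys M) k x)
    = dir_map (Gamma_sys N) k (Gamma_map_at k x).
Proof. exact: linear_ext. Qed.

Definition Lambda_map_at k : {linear Lambda_sys M k -> Lambda_sys N k} :=
  quot_map f (@expM_map M N f k).
Fact Lambda_map_atE k x :
  Lambda_map_at k (inv_map (Lambda_sys M) k x)
    = inv_map (Lambda_sys N) k (Lambda_map_at k.+1 x).
Proof.
by rewrite -[x]quot_piK /= !quot_map_pi.
Qed.
End Maps.
End IAdic.
Arguments Gamma_map_atE {R} I {M N} f k x.
Arguments Lambda_map_atE {R} I {M N} f k x.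

(* Endofunctors of the category of R-modules. *)
Record functor (R : comPzRingType) := Functor {
  fobj :> lmodType R -> lmodType R;
  fmap : forall M N : lmodType R, {linear M -> N} -> {linear fobj M -> fobj N};
  fmap_id : forall M : lmodType R, fmap (idfun : {linear M -> M}) =1 idfun;
  fmap_comp : forall (M N P : lmodType R) (g : {linear N -> P}) (f : {linear M -> N}),
    fmap (g \o f : {linear M -> P}) =1 fmap g \o fmap f }.
Arguments fmap {R} F {M N} f : rename.

Section Functors.
Variables (R : comPzRingType) (I : ideal R).

Fact Gamma_map_id (M : lmodType R) :
  colim_map (Gamma_map_atE I (idfun : {linear M -> M})) =1 idfun.
Proof.
move=> x; rewrite -[x]quot_piK [LHS]quot_map_pi; congr quot_pi.
apply: val_inj; apply: functional_extensionality_dep => k; exact: linear_ext.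
Qed.
Fact Gamma_map_comp (M N P : lmodType R) (g : {linear N -> P}) (f : {linear M -> N}) :
  colim_map (Gamma_map_atE I (g \o f : {linear M -> P}))
    =1 colim_map (Gamma_map_atE I g) \o colim_map (Gamma_map_atE I f).
Proof.
move=> x; rewrite -[x]quot_piK /= [LHS]quot_map_pi !quot_map_pi; congr quot_pi.
apply: val_inj; apply: functional_extensionality_dep => k; exact: linear_ext.
Qed.

Definition Gamma : functor R :=
  @Functor R (fun M => colim (Gamma_sys I M))
    (fun M N f => colim_map (Gamma_map_atE I f)) Gamma_map_id Gamma_map_comp.

Fact Lambda_map_id (M : lmodType R) :
  ilim_map (Lambda_map_atE I (idfun : {linear M -> M})) =1 idfun.
Proof.
move=> x; apply: val_inj; apply: functional_extensionality_dep => k.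
by rewrite /= /dprod_map -[val x k]quot_piK [LHS]quot_map_pi.
Qed.
Fact Lambda_map_comp (M N P : lmodType R) (g : {linear N -> P}) (f : {linear M -> N}) :
  ilim_map (Lambda_map_atE I (g \o f : {linear M -> P}))
    =1 ilim_map (Lambda_map_atE I g) \o ilim_map (Lambda_map_atE I f).
Proof.
move=> x; apply: val_inj; apply: functional_extensionality_dep => k.
by rewrite /= /dprod_map /Lambda_map_at /= -[val x k]quot_piK !quot_map_pi.
Qed.

Definition Lambda : functor R :=
  @Functor R (fun M => ilim (Lambda_sys I M))
    (fun M N f => ilim_map (Lambda_map_atE I f)) Lambda_map_id Lambda_map_comp.

Definition mulm (M : lmodType R) (a : R) : {linear M -> M} := *:%R a.

Definition reduced (M : lmodType R) : Prop :=
  forall a, a \in I -> Ker (mulm M a) ≅ Ker (mulm M a \o mulm M a).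

Definition coreduced (M : lmodType R) : Prop :=
  forall a, a \in I -> Coker (mulm M a) ≅ Coker (mulm M a \o mulm M a).

End Functors.

Section FullSubcategories.
Variables (R : comPzRingType) (F : functor R) (P Q : lmodType R -> Prop).

(* Full subcategories have all the morphisms, so restricting F to a functor
   from P to Q is a condition on objects only. *)
Definition restricts_to : Prop := forall M, P M -> Q (F M).

(* A natural isomorphism F \o F -> F on the full subcategory given by P. *)
Definition idempotent_on : Prop :=
  exists phi : forall M, P M -> {linear F (F M) -> F M},
    (forall M (PM : P M), bijective (phi M PM)) /\
    (forall (M N : lmodType R) (PM : P M) (PN : P N) (f : {linear M -> N}),
       phi N PN \o fmap F (fmap F f) =1 fmap F f \o phi M PM).

End FullSubcategories.

(* Main.v *)
Require Import Defs.
From HB Require Import structures.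
From mathcomp Require Import all_boot all_algebra.
From mathcomp Require Import boolp classical_sets cardinality fsbigop.

(** The hypotheses on [M] are abstract isomorphisms, but the kernel and the
cokernel of multiplication by [a] are annihilated by [a], and annihilation is
transported by isomorphisms.  So [I]-reduced means that [a^2 m = 0] implies
[a m = 0], and [I]-coreduced means that [a M = a^2 M], for every [a] in [I]
([reducedP], [coreducedP]).  By induction the square may be replaced by any
power, and this makes both limits stationary from exponent 1 on.

For torsion, evaluation at the class of 1 identifies [Gamma I M] with the
submodule of the elements of [M] killed by some [I^k] ([gamma_eval],
[gamma_eval_image]).  An element of a reduced module killed by [I^k] is killed
by each [a^k], hence by each [a] in [I]; so [Gamma I M] consists of the
elements killed by [I], which are also the values at 1 of the maps
[R/I -> M].

For completion, a coreduced module satisfies [I M = I^k M] for all [k >= 1],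
because [a M = a^k M].  So the canonical map [eta : M -> Lambda I M] is onto
with kernel [I M], which is also the kernel of the surjection [m |-> 1 ⊗ m]
onto [R/I ⊗ M].

Both [Gamma I M] and [Lambda I M] are then killed by [I].  A module killed by
[I] is both reduced and coreduced, and on it [gamma_eval] and [eta] are
bijective; this gives the two restrictions and the two idempotence statements,
the natural isomorphisms being [gamma_eval] and the inverse of [eta].

For the adjunction, composition with [eta] on one side and with [gamma_eval]
on the other embeds both [Hom] modules in [Hom(M, N)].  The two images agree:
both consist of the maps [M -> N] that vanish on [I M], equivalently that take
their values in the part of [N] killed by [I]. *)

Set Implicit Arguments.
Unset Strict Implicit.
Unset Printing Implicit Defensive.

Import Defs GRing.Theory.
Local Open Scope ring_scope.
Local Open Scope classical_set_scope.

(** * Linear maps determined by kernels and images *)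

Section Lifting.
Variable R : comPzRingType.

(** A pointwise choice of preimages under an injective linear map is unique, so
it is automatically linear. *)
Lemma lift_inj (U V W : lmodType R) (i : {linear U -> V}) (f : {linear W -> V}) :
    injective i -> (forall w, exists u, i u = f w) ->
  exists g : {linear W -> U}, i \o g =1 f.
Proof.
move=> i_inj fi; have [g gE] := choice fi.
have glin : linear g by move=> a x y; apply: i_inj; rewrite linearP !gE linearP.
pose gL : {linear W -> U} := HB.pack g (GRing.isLinear.Build R W U *:%R g glin).
by exists gL.
Qed.

(** Composing [f] with any section of [p], linear or not, gives a map that does
not depend on the section, because [f] vanishes on the kernel of [p]. *)
Lemma lift_surj (U V W : lmodType R) (p : {linear W -> U}) (f : {linear W -> V}) :
    (forall u, exists w, p w = u) -> (forall w, p w = 0 -> f w = 0) ->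
  exists g : {linear U -> V}, g \o p =1 f.
Proof.
move=> p_surj pf; have [s sE] := choice p_surj.
have fE x y : p x = p y -> f x = f y.
  by move=> pxy; apply/subr0_eq; rewrite -linearB pf // linearB pxy subrr.
have glin : linear (f \o s).
  by move=> a x y; rewrite /= -linearP; apply: fE; rewrite linearP !sE.
pose g : {linear U -> V} :=
  HB.pack (f \o s) (GRing.isLinear.Build R U V *:%R (f \o s) glin).
by exists g => w; apply: fE; rewrite sE.
Qed.

(** Used to compare two modules by embedding both in a third one: each embedding
lifts through the other, and the two lifts are mutually inverse. *)
Lemma iso_of_same_image (U V W : lmodType R) (i : {linear U -> W})
    (j : {linear V -> W}) :
    injective i -> injective j ->
    (forall w, (exists u, i u = w) <-> (exists v, j v = w)) -> U ≅ V.
Proof.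
move=> i_inj j_inj ij.
have [g gE] : exists g : {linear U -> V}, j \o g =1 i.
  by apply: lift_inj => // u; apply/ij; exists u.
have [h hE] : exists h : {linear V -> U}, i \o h =1 j.
  by apply: lift_inj => // v; apply/ij; exists v.
exists g, h => x.
  by apply: i_inj; rewrite -[LHS]/((i \o h) _) hE -[RHS]gE.
by apply: j_inj; rewrite -[LHS]/((j \o g) _) gE -[RHS]hE.
Qed.

(** The dual of [iso_of_same_image]: two quotients of [W] by the same submodule. *)
Lemma iso_of_same_kernel (U V W : lmodType R) (p : {linear W -> U})
    (q : {linear W -> V}) :
    (forall u, exists w, p w = u) -> (forall v, exists w, q w = v) ->
    (forall w, p w = 0 <-> q w = 0) -> U ≅ V.
Proof.
move=> p_surj q_surj pq.
have [g gE] : exists g : {linear U -> V}, g \o p =1 q.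
  by apply: lift_surj => // w /pq.
have [h hE] : exists h : {linear V -> U}, h \o q =1 p.
  by apply: lift_surj => // w /pq.
exists g, h => x.
  have [w <-] := p_surj x.
  by rewrite -[g _]/((g \o p) w) gE -[LHS]/((h \o q) w) hE.
have [w <-] := q_surj x.
by rewrite -[h _]/((h \o q) w) hE -[LHS]/((g \o p) w) gE.
Qed.

Lemma bij_linear_inv (U V : lmodType R) (f : {linear U -> V}) :
  bijective f -> exists g : {linear V -> U}, cancel f g /\ cancel g f.
Proof.
case=> g fK gK; have glin := can2_linear fK gK.
pose gL : {linear V -> U} := HB.pack g (GRing.isLinear.Build R V U *:%R g glin).
by exists gL.
Qed.

Lemma inj_surj_bij (U V : lmodType R) (f : {linear U -> V}) :
  injective f -> (forall v, exists u, f u = v) -> bijective f.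
Proof.
move=> f_inj f_surj; have [g gK] := choice f_surj.
by exists g => // x; apply: f_inj.
Qed.

Lemma ker0_inj (U V : lmodType R) (f : {linear U -> V}) :
  (forall u, f u = 0 -> u = 0) -> injective f.
Proof. by move=> f0 x y fxy; apply/subr0_eq/f0; rewrite linearB fxy subrr. Qed.

Lemma submod_iso (V : lmodType R) (S T : submodClosed V) :
  S =i T -> submod S ≅ submod T.
Proof.
move=> ST; apply: (@iso_of_same_image _ _ V val val); try exact: val_inj.
move=> w; split=> [] [[x xS] <-].
  by have xT : x \in T by [rewrite -ST]; exists (exist _ x xT).
by have xT : x \in S by [rewrite ST]; exists (exist _ x xT).
Qed.

Lemma quot_pi_eq0 (V : lmodType R) (S : submodClosed V) x :
  quot_pi S x = 0 <-> x \in S.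
Proof.
by rewrite -(linear0 (quot_pi S)); split=> [/quot_piP|xS]; last apply/quot_piP;
  rewrite subr0.
Qed.

Lemma quot_pi_surj (V : lmodType R) (S : submodClosed V) u :
  exists x, quot_pi S x = u.
Proof. by exists (repr u); apply: quot_piK. Qed.

Lemma quotmod_iso (V : lmodType R) (S T : submodClosed V) :
  S =i T -> quotmod S ≅ quotmod T.
Proof.
move=> ST; apply: (iso_of_same_kernel (@quot_pi_surj V S) (@quot_pi_surj V T)).
by move=> w; rewrite !quot_pi_eq0 ST.
Qed.

End Lifting.

Section QuotLift.
Variables (R : comPzRingType) (V W : lmodType R) (S : submodClosed V).
Variable f : {linear V -> W}.
Hypothesis f0 : forall x, x \in S -> f x = 0.

Definition quot_lift (_ : forall x, x \in S -> f x = 0) (x : quotmod S) : W :=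
  f (repr x).

Lemma quot_lift_pi x : quot_lift f0 (quot_pi S x) = f x.
Proof.
by apply/subr0_eq; rewrite -linearB; apply/f0/quot_piP; apply: quot_piK.
Qed.

Fact quot_lift_linear : linear (quot_lift f0).
Proof.
move=> a x y; rewrite -[x]quot_piK -[y]quot_piK -linearP !quot_lift_pi.
exact: linearP.
Qed.
HB.instance Definition _ := GRing.isLinear.Build R (quotmod S) W *:%R
  (quot_lift f0) quot_lift_linear.
End QuotLift.

Section ScaleBy.
Variables (R : comPzRingType) (W : lmodType R).

(** Named, and typed on [R^o], so that it can carry a linear structure. *)
Definition scale_by (w : W) (r : R^o) : W := r *: w.
Fact scale_by_linear w : linear (scale_by w).
Proof. by move=> r x y; rewrite /scale_by scalerDl -scalerA. Qed.
HB.instance Definition _ w := GRing.isLinear.Build R R^o W *:%R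
  (scale_by w) (scale_by_linear w).
End ScaleBy.

(** * Direct sums *)

Section DirectSum.
Variable R : comPzRingType.

Lemma dsum_ext (J : Type) (V : J -> lmodType R) (x y : dsum V) :
  (forall j, val x j = val y j) -> x = y.
Proof.
by move=> xy; apply: val_inj; apply: functional_extensionality_dep.
Qed.

Lemma dsum_support (J : choiceType) (V : J -> lmodType R) (x : dsum V) :
  exists2 r : seq J, uniq r & forall j, val x j != 0 -> j \in r.
Proof.
have /asboolP fx : val x \in finsupp (V := V) by apply: valP.
have /finite_seqP[r xr] := fx; exists (undup r); first exact: undup_uniq.
move=> j xj; rewrite mem_undup; suff : [set` r] j by [].
by rewrite -xr.
Qed.

Lemma dsum_inj_linear (J : eqType) (V : J -> lmodType R) j :
  linear (dsum_inj (V := V) (j := j)).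
Proof.
move=> a x y; apply: dsum_ext => i /=.
rewrite -[RHS]/(a *: dfwith _ x i + dfwith _ y i).
have [->|ij] := eqVneq i j; first by rewrite !dfwith_in.
by rewrite !dfwith_out 1?eq_sym // scaler0 addr0.
Qed.
HB.instance Definition _ (J : eqType) (V : J -> lmodType R) j :=
  GRing.isLinear.Build R (V j) (dsum V) *:%R (dsum_inj (V := V) (j := j))
    (@dsum_inj_linear J V j).

(** Peeling off one component at a time shrinks a list containing the support. *)
Lemma dsum_ind (J : choiceType) (V : J -> lmodType R) (P : dsum V -> Prop) :
    P 0 -> (forall j (v : V j) x, P x -> P (dsum_inj v + x)) ->
  forall x, P x.
Proof.
move=> P0 PD x; have [r _] := dsum_support x.
elim: r x => [|j r IHr] x xr.
  suff -> : x = 0 by [].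
  by apply: dsum_ext => j; apply/eqP/negbNE/negP => /xr.
rewrite -[x](subrKC (dsum_inj (val x j))); apply: PD; apply: IHr => i.
rewrite -[val _ i]/(val x i - dfwith _ (val x j) i).
have [->|ij] := eqVneq i j; first by rewrite dfwith_in subrr eqxx.
rewrite dfwith_out; last by rewrite eq_sym.
by rewrite subr0 => /xr; rewrite inE (negPf ij).
Qed.

Section Lift.
Variables (J : choiceType) (V : J -> lmodType R) (W : lmodType R).
Variable f : forall j, {linear V j -> W}.

(** The summand is nonzero at finitely many indices only, so the finitely
supported sum is the actual one, never its default value. *)
Definition dsum_lift (x : dsum V) : W := \sum_(j \in [set: J]) f j (val x j).

Lemma dsum_liftE (r : seq J) (x : dsum V) :
    uniq r -> (forall j, val x j != 0 -> j \in r) ->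
  dsum_lift x = \sum_(j <- r) f j (val x j).
Proof.
move=> ur xr; rewrite /dsum_lift (fsbigE r) // => [|j _ jr].
  by apply: eq_bigl => j; rewrite in_setT.
by have /eqP-> : val x j == 0 by [apply: contraNT jr; apply: xr]; rewrite linear0.
Qed.

Fact dsum_lift_linear : linear dsum_lift.
Proof.
move=> a x y; have [r _ xr] := dsum_support x; have [s _ ys] := dsum_support y.
(* A common list of indices, so that the three sums can be compared termwise. *)
have urs : uniq (undup (r ++ s)) by apply: undup_uniq.
have inx j : val x j != 0 -> j \in undup (r ++ s).
  by move=> /xr jr; rewrite mem_undup mem_cat jr.
have iny j : val y j != 0 -> j \in undup (r ++ s).
  by move=> /ys js; rewrite mem_undup mem_cat js orbT.
rewrite !(@dsum_liftE (undup (r ++ s))) //.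
  rewrite scaler_sumr -big_split; apply: eq_bigr => j _.
  by rewrite -[val _ j]/(a *: val x j + val y j) linearP.
move=> j; rewrite -[val _ j]/(a *: val x j + val y j).
have [xj|/inx //] := eqVneq (val x j) 0.
by rewrite xj scaler0 add0r; apply: iny.
Qed.
HB.instance Definition _ :=
  GRing.isLinear.Build R (dsum V) W *:%R dsum_lift dsum_lift_linear.

Lemma dsum_lift_inj j (v : V j) : dsum_lift (dsum_inj v) = f j v.
Proof.
rewrite (@dsum_liftE [:: j]) //; first by rewrite big_seq1 /= dfwith_in.
move=> i; rewrite inE; apply: contra_neqT => ij /=.
by rewrite dfwith_out // eq_sym.
Qed.

End Lift.
End DirectSum.

(** * Sequential colimits *)

Section Colimit.
Variables (R : comPzRingType) (X : dirsys R).

Definition colim_in k : {linear X k -> colim X} :=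
  quot_pi (span (@colim_rel R X)) \o dsum_inj (V := X) (j := k).

Lemma colim_in_map k (x : X k) : colim_in k.+1 (dir_map X k x) = colim_in k x.
Proof. by apply/quot_piP/sub_span; exists k, x. Qed.

Lemma colim_in_le j k (x : X j) :
  (j <= k)%N -> exists y : X k, colim_in k y = colim_in j x.
Proof.
move=> /subnKC <-; elim: (k - j)%N => [|n [y yE]].
  by rewrite addn0; exists x.
by rewrite addnS; exists (dir_map X _ y); rewrite colim_in_map.
Qed.

(** Along a sequence, two elements have representatives at a common stage, so a
sum of elements coming from finitely many stages comes from a single one. *)
Lemma colim_in_surj (z : colim X) : exists k (x : X k), colim_in k x = z.
Proof.
rewrite -[z]quot_piK; elim/dsum_ind: (repr z) => [|j v x [k [y yE]]].
  by exists 0%N, 0; rewrite !linear0.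
have [y' y'E] := colim_in_le y (leq_maxr j k).
have [v' v'E] := colim_in_le v (leq_maxl j k).
by exists (maxn j k), (v' + y'); rewrite linearD v'E y'E yE linearD.
Qed.

Section Lift.
Variables (W : lmodType R) (f : forall k, {linear X k -> W}).
Hypothesis fE : forall k x, f k.+1 (dir_map X k x) = f k x.

Fact colim_lift_rel z : z \in span (@colim_rel R X) -> dsum_lift f z = 0.
Proof.
move=> zS; apply/eqP; move: z zS; apply: (span_sub (S := kerm (dsum_lift f))).
by move=> _ [k [x ->]]; rewrite unfold_in linearB /= !dsum_lift_inj fE subrr.
Qed.

Definition colim_lift : {linear colim X -> W} :=
  quot_lift (f := dsum_lift f) colim_lift_rel.

Lemma colim_lift_in k x : colim_lift (colim_in k x) = f k x.
Proof. rewrite [LHS]quot_lift_pi; exact: (dsum_lift_inj f x). Qed.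

End Lift.
End Colimit.

(** * Tensor products *)

Section TensorProduct.
Variables (R : comPzRingType) (A B : lmodType R).

Definition tens (a : A) (b : B) : A ⊗ B := quot_pi _ (pair_gen a b).

Lemma tensDr a b b' : tens a (b + b') = tens a b + tens a b'.
Proof.
apply/subr0_eq; rewrite opprD addrA -!linearB; apply/quot_pi_eq0/sub_span.
exact: TensorDr.
Qed.

Lemma tensZl r a b : tens (r *: a) b = r *: tens a b.
Proof.
apply/subr0_eq; rewrite -linearZ -linearB; apply/quot_pi_eq0/sub_span.
exact: TensorZl.
Qed.

Lemma tensZr r a b : tens a (r *: b) = r *: tens a b.
Proof.
apply/subr0_eq; rewrite -linearZ -linearB; apply/quot_pi_eq0/sub_span.
exact: TensorZr.
Qed.

Fact tens_linear a : linear (tens a).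
Proof. by move=> r x y; rewrite tensDr tensZr. Qed.
HB.instance Definition _ a :=
  GRing.isLinear.Build R B (A ⊗ B) *:%R (tens a) (tens_linear a).

Lemma free_pairs_gen a b (r : R^o) :
  @dsum_inj R (A * B)%type (fun=> R^o : lmodType R) (a, b) r = r *: pair_gen a b.
Proof.
have {1}<- : r *: (1 : R^o) = r by apply: mulr1.
exact: (linearZ_LR (dsum_inj (V := fun=> R^o : lmodType R) (j := (a, b)))).
Qed.

Lemma tens_ind (P : A ⊗ B -> Prop) :
  P 0 -> (forall a b z, P z -> P (tens a b + z)) -> forall z, P z.
Proof.
move=> P0 PD z; rewrite -[z]quot_piK.
elim/dsum_ind: (repr z) => [|[a b] r x Px]; first by rewrite linear0.
rewrite linearD free_pairs_gen linearZ.
by have := PD (r *: a) b _ Px; rewrite tensZl.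
Qed.

Section Lift.
Variables (W : lmodType R) (f : A -> {linear B -> W}).
Hypothesis f_linear : forall r a a' b, f (r *: a + a') b = r *: f a b + f a' b.

Definition pairs_lift : {linear free_pairs A B -> W} :=
  dsum_lift (fun p => scale_by (f p.1 p.2) : {linear R^o -> W}).

Lemma pairs_lift_gen a b : pairs_lift (pair_gen a b) = f a b.
Proof. rewrite [LHS]dsum_lift_inj; exact: scale1r. Qed.

Fact tens_lift_rel z : z \in span (@tensor_rel R A B) -> pairs_lift z = 0.
Proof.
have fD a a' b : f (a + a') b = f a b + f a' b.
  by rewrite -{1}[a]scale1r f_linear scale1r.
have f0 b : f 0 b = 0 by apply: (addIr (f 0 b)); rewrite -fD add0r add0r.
have fZ r a b : f (r *: a) b = r *: f a b.
  by rewrite -[r *: a]addr0 f_linear f0 addr0.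
move=> zS; apply/eqP; move: z zS; apply: (span_sub (S := kerm pairs_lift)).
move=> _ [a a' b|a b b'|r a b|r a b]; rewrite unfold_in !linearB.
- by rewrite !pairs_lift_gen fD -addrA -opprD subrr.
- by rewrite !pairs_lift_gen linearD -addrA -opprD subrr.
- by rewrite linearZ !pairs_lift_gen fZ subrr.
- by rewrite linearZ !pairs_lift_gen linearZ subrr.
Qed.

Definition tens_lift : {linear A ⊗ B -> W} :=
  quot_lift (f := pairs_lift) tens_lift_rel.

Lemma tens_lift_tens a b : tens_lift (tens a b) = f a b.
Proof. by rewrite [LHS]quot_lift_pi pairs_lift_gen. Qed.

End Lift.
End TensorProduct.

(** * Maps out of a cyclic module *)

Section EvalAtOne.
Variables (R : comPzRingType) (J : ideal R) (M : lmodType R).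

Definition eval1 (h : HomR (quotmod J) M) : M := h (quot_pi J (1 : R^o)).
Fact eval1_linear : linear eval1. Proof. by []. Qed.
HB.instance Definition _ :=
  GRing.isLinear.Build R (HomR (quotmod J) M) M *:%R eval1 eval1_linear.

Lemma eval1_scale (h : HomR (quotmod J) M) (r : R^o) :
  h (quot_pi J r) = r *: eval1 h.
Proof.
rewrite /eval1; have {1}<- : r *: (1 : R^o) = r by apply: mulr1.
by rewrite !linearZ.
Qed.

Lemma eval1_inj : injective eval1.
Proof.
move=> g h gh; apply: linear_ext => x.
by rewrite -[x]quot_piK !eval1_scale gh.
Qed.

(** An element [m] killed by [J] is the value at 1 of the map induced on [R/J] by
[r |-> r m]. *)
Lemma eval1_image m :
  (exists h, eval1 h = m) <-> forall r, r \in J -> r *: m = 0.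
Proof.
split=> [[h <-] r rJ|Jm].
  by rewrite -eval1_scale (_ : quot_pi J r = 0) ?linear0 //; apply/quot_pi_eq0.
pose h : {linear quotmod J -> M} := quot_lift (f := scale_by m) Jm.
by exists h; rewrite [LHS]quot_lift_pi; apply: scale1r.
Qed.

End EvalAtOne.

(** * Reduced modules and torsion *)

Section Gamma.
Variables (R : comPzRingType) (I : ideal R).

Definition killed_by (M : lmodType R) (m : M) := forall a, a \in I -> a *: m = 0.

Lemma ideal_exp1 : ideal_exp I 1 =i I.
Proof.
move=> x; apply/idP/idP.
  apply: span_sub => _ [a [v [aI _ ->]]].
  by rewrite [a *: v]mulrC; apply: (rpredZ (v : R)).
by move=> xI; apply: sub_span; exists x, 1; split=> //; rewrite [RHS]mulr1.
Qed.

Lemma ideal_exp_le1 k x : x \in ideal_exp I k.+1 -> x \in I.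
Proof.
by elim: k x => [x|k IHk x /ideal_exp_sub/IHk //]; rewrite ideal_exp1.
Qed.

Lemma exp_in_ideal_exp (a : R) k : a \in I -> (a ^+ k : R^o) \in ideal_exp I k.
Proof.
move=> aI; elim: k => [//|k IHk]; apply: sub_span.
by exists a, (a ^+ k); split=> //; rewrite exprS.
Qed.

Section Eval.
Variable M : lmodType R.

Fact gamma_eval_map k (h : Gamma_sys I M k) :
  eval1 (dir_map (Gamma_sys I M) k h) = eval1 h.
Proof. by rewrite /eval1 /= /Hom_pre /= quot_map_pi. Qed.

(** The inclusion of the torsion submodule: evaluation at 1 does not change when
a map on [R/I^k] is composed with [R/I^(k+1) -> R/I^k]. *)
Definition gamma_eval : {linear Gamma I M -> M} :=
  colim_lift (X := Gamma_sys I M) (f := fun k => eval1 (J := ideal_exp I k) (M := M))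
    gamma_eval_map.

Lemma gamma_eval_in k (h : Gamma_sys I M k) :
  gamma_eval (colim_in (Gamma_sys I M) k h) = eval1 h.
Proof. exact: colim_lift_in. Qed.

(** Already injective at each stage, since a map on [R/I^k] is determined by its
value at 1. *)
Lemma gamma_eval_inj : injective gamma_eval.
Proof.
apply: ker0_inj => z; have [k [h <-]] := colim_in_surj z.
rewrite gamma_eval_in -(linear0 (@eval1 R (ideal_exp I k) M)) => /eval1_inj ->.
exact: linear0.
Qed.

Lemma gamma_eval_image m :
  (exists z, gamma_eval z = m) <->
  exists k, forall r, r \in ideal_exp I k -> r *: m = 0.
Proof.
split=> [[z <-]|[k /eval1_image[h <-]]].
  have [k [h <-]] := colim_in_surj z; exists k.
  by apply/eval1_image; exists h; rewrite gamma_eval_in.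
by exists (colim_in (Gamma_sys I M) k h); rewrite gamma_eval_in.
Qed.

Lemma killed_in_gamma m : killed_by m -> exists z, gamma_eval z = m.
Proof.
by move=> Im; apply/gamma_eval_image; exists 1 => r; rewrite ideal_exp1; apply: Im.
Qed.

End Eval.

Lemma gamma_eval_natural (M N : lmodType R) (f : {linear M -> N}) z :
  gamma_eval N (fmap (Gamma I) f z) = f (gamma_eval M z).
Proof.
have [k [h <-]] := colim_in_surj z.
rewrite gamma_eval_in /= quot_map_pi dsum_map_inj.
exact: (gamma_eval_in (f \o h : Gamma_sys I N k)).
Qed.

(** Every element of the kernel of [a] is killed by [a]; through the isomorphism
the same holds for the kernel of [a^2]. *)
Lemma reducedP (M : lmodType R) a (m : M) :
  reduced I M -> a \in I -> a *: (a *: m) = 0 -> a *: m = 0.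
Proof.
move=> redM aI aam; have [f [g _ gK]] := redM a aI.
have am : m \in kerm (mulm M a \o mulm M a) by apply/eqP.
pose x : Ker (mulm M a \o mulm M a) := exist _ m am.
have ag : a *: g x = 0 by apply: val_inj; apply/eqP; apply: (valP (g x)).
have: a *: x = 0 by rewrite -(gK x) -linearZ ag linear0.
by move/(congr1 val).
Qed.

Lemma reduced_exp (M : lmodType R) a (m : M) k :
  reduced I M -> a \in I -> a ^+ k *: m = 0 -> a *: m = 0.
Proof.
move=> redM aI; elim: k m => [|k IHk] m.
  by rewrite scale1r => ->; rewrite scaler0.
by rewrite exprSr -scalerA => /IHk; apply: reducedP.
Qed.

(** If [I^k] kills [m] then [a^k m = 0] for each [a] in [I], and reducedness
brings the exponent down to 1. *)
Lemma gamma_eval_reduced (M : lmodType R) (m : M) :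
  reduced I M -> (exists z, gamma_eval M z = m) <-> killed_by m.
Proof.
move=> redM; split=> [/gamma_eval_image[k Ikm] a aI|]; last exact: killed_in_gamma.
by apply: (@reduced_exp _ _ _ k) => //; apply/Ikm/exp_in_ideal_exp.
Qed.

(** The cokernel of [a] is killed by [a]; through the isomorphism so is the
cokernel of [a^2], that is, [a M] lies in [a^2 M]. *)
Lemma coreducedP (M : lmodType R) a (m : M) :
  coreduced I M -> a \in I -> exists n, a *: m = a *: (a *: n).
Proof.
move=> corM aI; have [f [g _ gK]] := corM a aI.
set S2 := imm (mulm M a \o mulm M a).
have ag y : a *: (y : Coker (mulm M a)) = 0.
  by rewrite -[y]quot_piK -linearZ; apply/quot_pi_eq0/asboolP; exists (repr y).
have am (y : Coker (mulm M a \o mulm M a)) : a *: y = 0.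
  by rewrite -(gK y) -linearZ ag linear0.
have : quot_pi S2 (a *: m) = 0 by rewrite linearZ; apply: am.
by move=> /quot_pi_eq0/asboolP[n nE]; exists n; rewrite -nE.
Qed.

Lemma coreduced_exp (M : lmodType R) a (m : M) k :
  coreduced I M -> a \in I -> exists n, a *: m = a ^+ k.+1 *: n.
Proof.
move=> corM aI; elim: k => [|k [n ->]]; first by exists m.
have [p pE] := coreducedP n corM aI; exists p.
by rewrite exprSr -scalerA pE scalerA -exprSr scalerA -exprSr.
Qed.

(** On a module killed by [I] both [a] and [a^2] act as zero, so they have the
same kernel and, in [killed_coreduced], the same image. *)
Lemma killed_reduced (M : lmodType R) :
  (forall m : M, killed_by m) -> reduced I M.
Proof.
move=> IM a aI; apply: submod_iso => m; rewrite !unfold_in /= /mulm /=.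
by rewrite (IM m a aI) scaler0.
Qed.

Lemma killed_coreduced (M : lmodType R) :
  (forall m : M, killed_by m) -> coreduced I M.
Proof.
move=> IM a aI; apply: quotmod_iso => m; apply/asboolP/asboolP=> -[n <-]; exists n.
  by rewrite /= /mulm /= !(IM _ a aI).
by rewrite /= /mulm /= !(IM _ a aI).
Qed.

Lemma gamma_killed (M : lmodType R) (z : Gamma I M) : reduced I M -> killed_by z.
Proof.
move=> redM a aI; apply: (@gamma_eval_inj M); rewrite linearZ linear0.
by apply: (proj1 (gamma_eval_reduced _ redM)) => //; exists z.
Qed.

End Gamma.

(** * Coreduced modules and completion *)

Section Lambda.
Variables (R : comPzRingType) (I : ideal R).

Lemma expM0 (M : lmodType R) (m : M) : m \in expM I M 0.
Proof. by apply: sub_span; exists 1, m; split; rewrite ?scale1r. Qed.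

Lemma expM_killed (M : lmodType R) k (m : M) :
  (forall m : M, killed_by I m) -> m \in expM I M k.+1 -> m = 0.
Proof.
move=> IM mI; apply/eqP; move: m mI.
apply: (span_sub (S := kerm (idfun : {linear M -> M}))).
move=> _ [a [v [aI _ ->]]]; apply/eqP; exact: (IM v a (ideal_exp_le1 aI)).
Qed.

(** [I M] is generated by the elements [a v], and [a v] lies in [a^k M], which is
contained in [I^k M]. *)
Lemma expM_coreduced (M : lmodType R) k (m : M) :
  coreduced I M -> m \in expM I M 1 -> m \in expM I M k.
Proof.
move=> corM; move: m; apply: span_sub => _ [a [v [aI _ ->]]].
case: k => [|k]; first exact: expM0.
rewrite ideal_exp1 in aI; have [n ->] := coreduced_exp v k corM aI.
by apply: sub_span; exists (a ^+ k.+1), n; split=> //; apply: exp_in_ideal_exp.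
Qed.

Section Eta.
Variable M : lmodType R.

Fact eta_compatible (m : M) :
  ((fun k => quot_pi (expM I M k) m) : dprod (Lambda_sys I M))
    \in compatible (X := Lambda_sys I M).
Proof. by apply/asboolP => k; rewrite /= quot_map_pi. Qed.

Definition eta (m : M) : Lambda I M :=
  exist (fun x => x \in compatible (X := Lambda_sys I M)) _ (eta_compatible m).
Fact eta_linear : linear eta.
Proof.
move=> a x y; apply: val_inj; apply: functional_extensionality_dep => k.
exact: (linearP (quot_pi (expM I M k))).
Qed.
HB.instance Definition _ :=
  GRing.isLinear.Build R M (Lambda I M) *:%R eta eta_linear.

Lemma eta_eq0 m : eta m = 0 <-> forall k, m \in expM I M k.
Proof.
split=> [m0 k|mI]; first by apply/quot_pi_eq0; rewrite -[LHS]/(val (eta m) k) m0.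
apply: val_inj; apply: functional_extensionality_dep => k.
by apply/quot_pi_eq0.
Qed.

Hypothesis corM : coreduced I M.

Lemma eta_eq0_coreduced m : eta m = 0 <-> m \in expM I M 1.
Proof.
rewrite eta_eq0; split=> [|mI k]; first exact.
exact: expM_coreduced.
Qed.

(** A compatible sequence is determined by its component of index 1: the
components of higher index are known modulo [I M], which is also [I^k M]. *)
Lemma eta_surj (x : Lambda I M) : exists m, eta m = x.
Proof.
have /asboolP xC : val x \in compatible (X := Lambda_sys I M) by apply: valP.
have [m mE] := quot_pi_surj (val x 1%N); exists m.
apply: val_inj; apply: functional_extensionality_dep => k /=.
have [n nE] := quot_pi_surj (val x k); rewrite -nE; apply/quot_piP.
(* At index 0 the quotient is zero, so any two classes agree there. *)
case: k nE => [|k] nE; first exact: expM0.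
apply: expM_coreduced => //; apply/quot_piP; rewrite mE.
elim: k n nE => [|k IHk] n nE; first exact: esym.
by apply: IHk; rewrite -xC -nE /= quot_map_pi.
Qed.

Lemma lambda_killed (x : Lambda I M) : killed_by I x.
Proof.
move=> a aI; have [m <-] := eta_surj x; rewrite -linearZ.
apply/eta_eq0_coreduced/sub_span; exists a, m; split=> //.
by rewrite ideal_exp1.
Qed.

End Eta.

Lemma eta_bij (M : lmodType R) :
  (forall m : M, killed_by I m) -> bijective (@eta M).
Proof.
move=> IM; apply: inj_surj_bij; last exact/eta_surj/killed_coreduced.
by apply: ker0_inj => m /eta_eq0/(_ 1%N); apply: expM_killed.
Qed.

Lemma eta_natural (M N : lmodType R) (f : {linear M -> N}) m :
  fmap (Lambda I) f (eta m) = eta (f m).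
Proof.
apply: val_inj; apply: functional_extensionality_dep => k.
by rewrite /= /dprod_map /Lambda_map_at /= quot_map_pi.
Qed.

End Lambda.

(** * The tensor product with R/I *)

Section TensorQuotient.
Variables (R : comPzRingType) (I : ideal R) (M : lmodType R).

Definition tens1 : {linear M -> quotmod I ⊗ M} := tens (quot_pi I (1 : R^o)).

Lemma quot_tens (r : R^o) m : tens (quot_pi I r) m = tens1 (r *: m).
Proof.
rewrite /tens1 /= tensZr -tensZl -linearZ; congr (tens (quot_pi I _) m).
by rewrite [RHS]mulr1.
Qed.

Lemma tens1_surj z : exists m, tens1 m = z.
Proof.
elim/tens_ind: z => [|x m z [n <-]]; first by exists 0; rewrite linear0.
by rewrite -[x]quot_piK quot_tens; eexists; rewrite -linearD.
Qed.

Fact scale_quot_rel (r : R^o) :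
  r \in I -> scale_by (quot_pi (expM I M 1) : HomR _ _) r = 0.
Proof.
move=> rI; apply: linear_ext => m; rewrite -[LHS]linearZ.
apply/quot_pi_eq0/sub_span; exists r, m; split=> //.
by rewrite ideal_exp1.
Qed.

(** Membership in [I M] is detected by the map [R/I ⊗ M -> M / I M] sending
[r ⊗ m] to the class of [r m], which sends [1 ⊗ m] to the class of [m]. *)
Lemma tens1_eq0 m : tens1 m = 0 <-> m \in expM I M 1.
Proof.
split; last first.
  move: m; suff H: {subset expM I M 1 <= kerm tens1} by move=> m /H/eqP.
  apply: span_sub => _ [a [v [aI _ ->]]]; rewrite ideal_exp1 in aI.
  apply/eqP; rewrite -quot_tens (_ : quot_pi I a = 0); last exact/quot_pi_eq0.
  by rewrite -(scale0r 0) tensZl scale0r.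
(* The bilinear map (r, m) |-> r m, curried: R/I acts on the projection of M
   onto M / I M. *)
pose h : {linear quotmod I -> HomR M (quotmod (expM I M 1))} :=
  quot_lift (f := scale_by (quot_pi (expM I M 1) : HomR _ _)) scale_quot_rel.
have hD r x y n : h (r *: x + y) n = r *: h x n + h y n by rewrite linearP.
move/(congr1 (tens_lift hD)); rewrite linear0 tens_lift_tens.
have -> : h (quot_pi I (1 : R^o)) = quot_pi (expM I M 1) :> HomR _ _.
  by rewrite [LHS]quot_lift_pi; apply: scale1r.
by move/quot_pi_eq0.
Qed.
End TensorQuotient.

(** * The isomorphisms *)

Section MainIsos.
Variables (R : comPzRingType) (I : ideal R).

Lemma gamma_hom_iso (M : lmodType R) :
  reduced I M -> Gamma I M ≅ HomR (quotmod I) M.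
Proof.
move=> redM; apply: iso_of_same_image (@gamma_eval_inj R I M) (@eval1_inj R I M) _.
by move=> m; rewrite eval1_image gamma_eval_reduced.
Qed.

Lemma lambda_tensor_iso (M : lmodType R) :
  coreduced I M -> Lambda I M ≅ quotmod I ⊗ M.
Proof.
move=> corM; apply: iso_of_same_kernel (eta_surj corM) (@tens1_surj R I M) _.
by move=> m; rewrite tens1_eq0 eta_eq0_coreduced.
Qed.

(** A map that factors through [eta] takes values killed by [I], because
[Lambda I M] is, so it lifts to [Gamma I N]; a map that factors through
[gamma_eval] kills [I M], because [Gamma I N] is killed by [I], so it descends
to [Lambda I M]. *)
Lemma lambda_gamma_adjunction (N M : lmodType R) :
  reduced I N -> coreduced I M -> HomR (Lambda I M) N ≅ HomR M (Gamma I N).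
Proof.
move=> redN corM.
apply: (@iso_of_same_image _ _ _ (HomR M N) (Hom_pre (@eta R I M))
          (Hom_post (gamma_eval I N))).
- move=> g h gh; apply: linear_ext => x; have [m <-] := eta_surj corM x.
  exact: (congr1 (fun f : {linear M -> N} => f m) gh).
- move=> g h gh; apply: linear_ext => m; apply: gamma_eval_inj.
  exact: (congr1 (fun f : {linear M -> N} => f m) gh).
move=> f; split=> [[g <-]|[g <-]].
  have [h hE] : exists h : {linear M -> Gamma I N},
      gamma_eval I N \o h =1 g \o @eta R I M.
    apply: lift_inj (@gamma_eval_inj R I N) _ => m.
    apply: killed_in_gamma => a aI.
    by rewrite /= -linearZ (lambda_killed corM) // linear0.
  by exists h; apply: linear_ext.
have [h hE] : exists h : {linear Lambda I M -> N},
    h \o @eta R I M =1 gamma_eval I N \o g.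
  apply: lift_surj (eta_surj corM) _ => m /(eta_eq0_coreduced corM).
  move: m; suff H : {subset expM I M 1 <= kerm (gamma_eval I N \o g)}.
    by move=> m /H/eqP.
  apply: span_sub => _ [a [v [aI _ ->]]]; rewrite ideal_exp1 in aI.
  have gav : g (a *: v) = 0 by rewrite linearZ; apply: gamma_killed.
  by apply/eqP; rewrite -[LHS]/(gamma_eval I N (g (a *: v))) gav linear0.
by exists h; apply: linear_ext.
Qed.

End MainIsos.

Theorem theorem1p1 (R : comPzRingType) (I : ideal R) :
  (restricts_to (Gamma I) (reduced I) (coreduced I) /\
   idempotent_on (Gamma I) (reduced I) /\
   forall M : lmodType R, reduced I M -> Gamma I M ≅ HomR (quotmod I) M) /\
  (restricts_to (Lambda I) (coreduced I) (reduced I) /\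
   idempotent_on (Lambda I) (coreduced I) /\
   forall M : lmodType R, coreduced I M -> Lambda I M ≅ quotmod I ⊗ M) /\
  (forall N M : lmodType R, reduced I N -> coreduced I M ->
     HomR (Lambda I M) N ≅ HomR M (Gamma I N)).
Proof.
split; [split; [|split] | split; [split; [|split] |]].
- by move=> M redM; apply: killed_coreduced => z; apply: gamma_killed.
- exists (fun M _ => gamma_eval I (Gamma I M)); split=> [M redM|M N _ _ f z].
    apply: inj_surj_bij => [|z]; first exact: gamma_eval_inj.
    exact/killed_in_gamma/gamma_killed.
  exact: gamma_eval_natural.
- exact: gamma_hom_iso.
- by move=> M corM; apply: killed_reduced => x; apply: lambda_killed.
(* [eta] goes from Lambda M to Lambda (Lambda M), so its inverse is chosen. *)
- have etaV M (corM : coreduced I M) :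
      {g : {linear Lambda I (Lambda I M) -> Lambda I M} |
        cancel (@eta _ I _) g /\ cancel g (@eta _ I _)}.
    exact/cid/bij_linear_inv/eta_bij/lambda_killed.
  exists (fun M corM => sval (etaV M corM)); split=> [M corM|M N corM corN f x].
    by case: (etaV M corM) => g [etaK gK]; exists (@eta _ I _).
  case: (etaV M corM) (etaV N corN) => g [_ gK] [h [etaK _]] /=.
  by rewrite -{1}(gK x) eta_natural etaK.
- exact: lambda_tensor_iso.
- exact: lambda_gamma_adjunction.
Qed.
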